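(* Let $R$ be an indecomposable commutative ring. Then the category $\mathbf{Sp}_R$ of Specker $R$-algebras is dually equivalent to the category $\mathbf{Stone}$ of Stone spaces.
   Context: All algebras are commutative and unital and all algebra homomorphisms are unital. A commutative ring $R$ with $1\ne0$ is indecomposable if its only idempotents are $0$ and $1$. For a commutative $R$-algebra $S$, $\mathrm{Id}(S)$ is the set of idempotents of $S$, a Boolean algebra under $e\vee f=e+f-ef$, $e\wedge f=ef$, $\lnot e=1-e$. A nonzero idempotent $e\in S$ is faithful if for each $a\in R$, $ae=0$ implies $a=0$. A faithful generating algebra of idempotents of $S$ is a Boolean subalgebra $B$ of $\mathrm{Id}(S)$ that generates $S$ as an $R$-algebra and all of whose nonzero elements are faithful. $S$ is a Specker $R$-algebra if it is a commutative $R$-algebra that has a faithful generating algebra of idempotents. $\mathbf{Sp}_R$ is the category of Specker $R$-algebras and $R$-algebra homomorphisms. $\mathbf{Stone}$ is the category of zero-dimensional compact Hausdorff spaces (including the empty space) and continuous maps. *)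

(* Defs.v *)
From HB Require Import structures.
From mathcomp Require Import all_boot all_algebra.
From mathcomp Require Import all_classical.
From mathcomp Require Import topology.

Set Implicit Arguments.
Unset Strict Implicit.
Unset Printing Implicit Defensive.
Import GRing.Theory.
Local Open Scope classical_set_scope.
Local Open Scope ring_scope.

Record category := Category {
  Ob :> Type;
  Hom : Ob -> Ob -> Type;
  idm : forall X, Hom X X;
  comp : forall X Y Z, Hom Y Z -> Hom X Y -> Hom X Z;
  comp1m : forall X Y (f : Hom X Y), comp (idm Y) f = f;
  compm1 : forall X Y (f : Hom X Y), comp f (idm X) = f;
  compA : forall X Y Z W (h : Hom Z W) (g : Hom Y Z) (f : Hom X Y),
    comp h (comp g f) = comp (comp h g) f }.

Arguments Hom {c}.
Arguments idm {c}.
Arguments comp {c X Y Z}.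

Definition opposite (C : category) : category := {|
  Ob := Ob C;
  Hom := fun X Y => @Hom C Y X;
  idm := @idm C;
  comp := fun X Y Z g f => @comp C Z Y X f g;
  comp1m := fun X Y f => @compm1 C Y X f;
  compm1 := fun X Y f => @comp1m C Y X f;
  compA := fun X Y Z W h g f => esym (@compA C W Z Y X f g h) |}.

Record functor (C D : category) := Functor {
  fob :> C -> D;
  fhom : forall X Y : C, Hom X Y -> Hom (fob X) (fob Y);
  fhom1 : forall X : C, fhom (idm X) = idm (fob X);
  fhomM : forall (X Y Z : C) (g : Hom Y Z) (f : Hom X Y),
    fhom (comp g f) = comp (fhom g) (fhom f) }.

Arguments fhom {C D} _ {X Y}.

Definition functor_id (C : category) : functor C C := {|
  fob := fun X => X;
  fhom := fun X Y f => f;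
  fhom1 := fun X => erefl;
  fhomM := fun X Y Z g f => erefl |}.

Lemma functor_comp_id (C D E : category) (G : functor D E) (F : functor C D)
  (X : C) : fhom G (fhom F (idm X)) = idm (G (F X)).
Proof. by rewrite !fhom1. Qed.

Lemma functor_comp_comp (C D E : category) (G : functor D E) (F : functor C D)
    (X Y Z : C) (g : Hom Y Z) (f : Hom X Y) :
  fhom G (fhom F (comp g f)) = comp (fhom G (fhom F g)) (fhom G (fhom F f)).
Proof. by rewrite !fhomM. Qed.

Definition functor_comp (C D E : category) (G : functor D E) (F : functor C D) :
    functor C E := {|
  fob := fun X => G (F X);
  fhom := fun X Y f => fhom G (fhom F f);
  fhom1 := functor_comp_id G F;
  fhomM := functor_comp_comp G F |}.

Definition isomorphism (C : category) (X Y : C) (f : Hom X Y) : Prop :=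
  exists g : Hom Y X, comp g f = idm X /\ comp f g = idm Y.

Definition naturally_isomorphic (C D : category) (F G : functor C D) : Prop :=
  exists eta : forall X : C, Hom (F X) (G X),
    (forall (X Y : C) (f : Hom X Y),
       comp (eta Y) (fhom F f) = comp (fhom G f) (eta X)) /\
    (forall X : C, isomorphism (eta X)).

Definition equivalent (C D : category) : Prop :=
  exists (F : functor C D) (G : functor D C),
    naturally_isomorphic (functor_id C) (functor_comp G F) /\
    naturally_isomorphic (functor_comp F G) (functor_id D).

Definition dually_equivalent (C D : category) : Prop :=
  equivalent (opposite C) D.

(* The library's [comAlgType R] requires [1 != 0], which would exclude the zero
   algebra; the latter is a Specker algebra, corresponding to the empty space.
   A commutative R-algebra is therefore a possibly trivial commutative ring
   together with its structure morphism from R. *)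
Record comPzAlg (R : comPzRingType) := ComPzAlg {
  alg_sort :> comPzRingType;
  alg_map : {rmorphism R -> alg_sort} }.

Definition alg_scale (R : comPzRingType) (S : comPzAlg R) (a : R) (x : S) : S :=
  alg_map S a * x.

Notation "a *a: x" := (alg_scale a x) (at level 40) : ring_scope.

Section AlgebraHomomorphisms.
Variable R : comPzRingType.

Record alg_hom (S T : comPzAlg R) := AlgHom {
  alg_hom_fun :> {rmorphism S -> T};
  alg_hom_scale : forall (a : R) (x : S),
    alg_hom_fun (a *a: x) = a *a: alg_hom_fun x }.

Lemma rmorphism_ext (S T : pzRingType) (f g : {rmorphism S -> T}) :
  f =1 g -> f = g.
Proof.
case: f g => [f [[f0] [fM]]] [g [[g0] [gM]]] /= /funext fg; subst g.
by rewrite (Prop_irrelevance f0 g0) (Prop_irrelevance fM gM).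
Qed.

Lemma alg_hom_ext (S T : comPzAlg R) (f g : alg_hom S T) : f =1 g -> f = g.
Proof.
case: f g => [f fZ] [g gZ] /= /rmorphism_ext fg; subst g.
by rewrite (Prop_irrelevance fZ gZ).
Qed.

Definition alg_hom_id (S : comPzAlg R) : alg_hom S S :=
  @AlgHom S S idfun (fun a x => erefl).

Lemma comp_alg_hom_scale (S T U : comPzAlg R) (g : alg_hom T U)
    (f : alg_hom S T) (a : R) (x : S) :
  (g \o f) (a *a: x) = a *a: (g \o f) x.
Proof. by rewrite /= !alg_hom_scale. Qed.

Definition alg_hom_comp (S T U : comPzAlg R) (g : alg_hom T U)
  (f : alg_hom S T) : alg_hom S U := AlgHom (comp_alg_hom_scale g f).

End AlgebraHomomorphisms.

Definition idem (S : pzRingType) : set S := [set e | e * e = e].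

Definition indecomposable (R : comNzRingType) : Prop :=
  forall e : R, idem e -> e = 0 \/ e = 1.

Definition boolean_subalgebra (S : comPzRingType) (B : set S) : Prop :=
  [/\ B `<=` @idem S, B 0, B 1,
      forall e f, B e -> B f -> B (e + f - e * f) /\ B (e * f) &
      forall e, B e -> B (1 - e)].

Section Specker.
Variables (R : comPzRingType) (S : comPzAlg R).

Definition faithful (e : S) : Prop := forall a : R, a *a: e = 0 -> a = 0.

Definition subalgebra (A : set S) : Prop :=
  [/\ A 1,
      forall (a : R) (x y : S), A x -> A y -> A (a *a: x + y) &
      forall x y : S, A x -> A y -> A (x * y)].

Definition generates (B : set S) : Prop :=
  forall A : set S, subalgebra A -> B `<=` A -> A = setT.

Definition faithful_generating_algebra (B : set S) : Prop :=
  [/\ boolean_subalgebra B, generates B &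
      forall e : S, B e -> e != 0 -> faithful e].

Definition specker : Prop := exists B : set S, faithful_generating_algebra B.

End Specker.

Record speckerAlg (R : comPzRingType) := SpeckerAlg {
  specker_sort :> comPzAlg R;
  specker_sortP : specker specker_sort }.

Definition Sp (R : comPzRingType) : category.
Proof.
exists (speckerAlg R) (fun S T => alg_hom S T)
  (fun S => alg_hom_id S) (fun S T U g f => alg_hom_comp g f).
- by move=> S T f; apply: alg_hom_ext.
- by move=> S T f; apply: alg_hom_ext.
- by move=> S T U V h g f; apply: alg_hom_ext.
Defined.

(* Zero-dimensionality is the existence of a base of clopen sets; the
   library's [zero_dimensional] is the separation of points by clopen sets,
   which is equivalent for compact Hausdorff spaces but not in general. *)
Record stoneSpace := StoneSpace {
  stone_sort :> topologicalType;
  stone_basis : basis (@clopen stone_sort);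
  stone_compact : compact [set: stone_sort];
  stone_hausdorff : hausdorff_space stone_sort }.

Definition Stone : category.
Proof.
exists stoneSpace (fun X Y : stoneSpace => continuousType X Y)
  (fun X : stoneSpace => @idfun X : continuousType X X)
  (fun (X Y Z : stoneSpace) (g : continuousType Y Z) (f : continuousType X Y) =>
     (g \o f) : continuousType X Z).
- by move=> X Y f; apply/continuousEP.
- by move=> X Y f; apply/continuousEP.
- by move=> X Y Z W h g f; apply/continuousEP.
Defined.

(* Main.v *)
(** A Specker algebra S is sent to the space of its R-valued characters, with
    the sets [phi e = 1] for e idempotent as a base, and a Stone space X to the
    algebra of locally constant functions X -> R.  As R is indecomposable,
    characters take only the values 0 and 1 on idempotents, so a character
    restricts to an ultrafilter U of the generating Boolean algebra B.
    Conversely, since B generates S, each s in S satisfies s * e = a e for some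
    a in R and e in U, and faithfulness makes a unique: s |-> a is a
    character.  Existence of ultrafilters then gives compactness of the spectrum
    and injectivity of s |-> (phi |-> phi s); surjectivity comes from a
    Stone-Weierstrass argument. *)
From HB Require Import structures.
From mathcomp Require Import all_boot all_algebra.
From mathcomp Require Import all_classical topology ring.
Require Import Defs.

Set Implicit Arguments.
Unset Strict Implicit.
Unset Printing Implicit Defensive.
Import GRing.Theory.
Local Open Scope classical_set_scope.
Local Open Scope ring_scope.

(** * Symmetry of natural isomorphism *)

Lemma naturally_isomorphic_sym (C D : category) (F G : functor C D) :
  naturally_isomorphic F G -> naturally_isomorphic G F.
Proof.
move=> [eta [nat_eta iso_eta]].
have [theta thetaK] : {theta : forall X, Hom (G X) (F X) & forall X,
    comp (theta X) (eta X) = idm (F X) /\ comp (eta X) (theta X) = idm (G X)}.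
  by exists (fun X => projT1 (cid (iso_eta X))) => X; case: cid.
exists theta; split; last by move=> X; exists (eta X); case: (thetaK X).
move=> X Y f; have [_ etaXK] := thetaK X; have [invYK _] := thetaK Y.
(* Inserting [eta X] composed with [theta X] on the right makes naturality of [eta] applicable; then
   [theta Y] cancels against [eta Y]. *)
rewrite -[LHS]compm1 -etaXK -compA (compA _ (eta X)) -nat_eta.
by rewrite -compA (compA (theta Y)) invYK comp1m.
Qed.

(** * Ultrafilters of a Boolean algebra of idempotents *)

(** Upward closure follows from these clauses: if [u] is in [U], [b] in [B] and [u * b = u], then
    [1 - b] in [U] would put [u * (1 - b) = 0] in [U]. *)
Definition boolean_ultrafilter (S : comPzRingType) (B U : set S) : Prop :=
  [/\ U `<=` B, ~ U 0, forall e f, U e -> U f -> U (e * f) &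
      forall b, B b -> U b \/ U (1 - b)].

Lemma boolean_ultrafilter1 (S : comPzRingType) (B U : set S) :
  boolean_subalgebra B -> boolean_ultrafilter B U -> U 1.
Proof.
by move=> [_ B0 _ _ _] [_ U0 _ /(_ 0 B0)[/U0//|]]; rewrite subr0.
Qed.

(* By Zorn's lemma: a maximal multiplicative subset of B on which s does not
   vanish is an ultrafilter. *)
Lemma exists_boolean_ultrafilter (S : comPzRingType) (B : set S) (s : S) :
  boolean_subalgebra B -> s != 0 ->
  exists2 U, boolean_ultrafilter B U & forall e, U e -> s * e != 0.
Proof.
move=> [Bidem B0 B1 BM BN] s0.
pose P (V : set S) := [/\ V `<=` B, forall e f, V e -> V f -> V (e * f) &
  forall e, V e -> s * e != 0].
have [F FP Ftot|U [[UB UM Us] Umax]] := @Zorn_bigcup _ P.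
  split.
  - by move=> e [V /FP[VB _ _]] /VB.
  - move=> e f [V FV Ve] [W FW Wf].
    have [VW|WV] := Ftot _ _ FV FW.
      by exists W => //; have [_ + _] := FP _ FW; apply=> //; exact: VW.
    by exists V => //; have [_ + _] := FP _ FV; apply=> //; exact: WV.
  - by move=> e [V /FP[_ _]]; apply.
have maxU (V : set S) : U `<=` V -> P V -> V `<=` U.
  by move=> UV PV; apply: contrapT => VU; exact: (Umax V).
(* [P] admits the empty set, so [1] has to be adjoined by maximality; this uses [s != 0]. *)
have U1 : U 1.
  apply: (maxU [set e | U e \/ e = 1]) => [e ?||]; [by left| |by right].
  split.
  - by move=> e [/UB//|->].
  - move=> e f [Ue|->] [Uf|->]; rewrite ?mulr1 ?mul1r; 
      [left|left|left|right] => //; exact: UM.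
  - by move=> e [/Us//|->]; rewrite mulr1.
(* If [s * v * b] never vanishes, adjoining all products [v * b] to [U] preserves [P], so maximality
   puts [b] in [U]. *)
have meet_or_zero b : B b -> U b \/ exists2 v, U v & s * v * b = 0.
  move=> Bb; have [?|/forall2NP nb] :=
    pselect (exists2 v, U v & s * v * b = 0); first by right.
  have bb : b * b = b by exact: Bidem.
  left; apply: (maxU [set e | U e \/ exists2 v, U v & e = v * b]).
  - by move=> e Ue; left.
  - split.
    + move=> e [/UB//|[v /UB Bv ->]].
      by have [] := BM _ _ Bv Bb.
    + move=> e f [Ue|[v Uv ->]] [Uf|[w Uw ->]].
      * by left; exact: UM.
      * by right; exists (e * w); [exact: UM|rewrite mulrA].
      * by right; exists (v * f); [exact: UM|ring].
      * by right; exists (v * w); [exact: UM|rewrite -[in RHS]bb; ring].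
    + move=> e [/Us//|[v Uv ->]]; rewrite mulrA; apply/eqP => svb.
      by have [] := nb v.
  - by right; exists 1 => //; rewrite mul1r.
exists U => //; split => //.
- by move=> /Us; rewrite mulr0 eqxx.
- move=> b Bb; have [|[v Uv svb]] := meet_or_zero b Bb; first by left.
  have [|[w Uw swb]] := meet_or_zero _ (BN _ Bb); first by right.
  have /Us/eqP[] := UM _ _ Uv Uw.
  (* If both [b] and [1 - b] were missing, splitting along [b] would make [s] vanish on [v * w], a
     member of [U]. *)
  have -> : s * (v * w) = w * (s * v * b) + v * (s * w * (1 - b)) by ring.
  by rewrite svb swb !mulr0 addr0.
Qed.

(** * Characters and algebra homomorphisms *)

Definition base_alg (R : comPzRingType) : comPzAlg R := @ComPzAlg R R idfun.

(** A name of its own, so that the topology below can be attached to it. *)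
Definition spectrum (R : comPzRingType) (S : comPzAlg R) : Type :=
  alg_hom S (base_alg R).

HB.instance Definition _ R S := gen_eqMixin (@spectrum R S).
HB.instance Definition _ R S := gen_choiceMixin (@spectrum R S).
Identity Coercion spectrum_alg_hom : spectrum >-> alg_hom.

Section AlgebraFacts.
Variable R : comPzRingType.
Implicit Types S T : comPzAlg R.

Lemma spectrumZ S (phi : spectrum S) a x : phi (a *a: x) = a * phi x.
Proof. exact: alg_hom_scale. Qed.

Lemma alg_hom_bij_inverse S T (f : alg_hom S T) : bijective f ->
  exists g : alg_hom T S, cancel f g /\ cancel g f.
Proof.
move=> [g fK gK].
have gB : zmod_morphism g.
  by move=> x y; apply: (can_inj fK); rewrite rmorphB !gK.
have gM : monoid_morphism g.
  split; first by apply: (can_inj fK); rewrite rmorph1 gK.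
  by move=> x y; apply: (can_inj fK); rewrite rmorphM !gK.
pose gA := GRing.isZmodMorphism.Build _ _ g gB.
pose gMM := GRing.isMonoidMorphism.Build _ _ g gM.
pose gR : {rmorphism T -> S} := HB.pack g gA gMM.
have gZ a x : gR (a *a: x) = a *a: gR x.
  by apply: (can_inj fK); rewrite alg_hom_scale /= !gK.
by exists (AlgHom gZ).
Qed.

Lemma range_subalgebra S T (f : alg_hom S T) : subalgebra (range f).
Proof.
split.
- by exists 1 => //; exact: rmorph1.
- move=> a _ _ [x _ <-] [y _ <-]; exists (a *a: x + y) => //.
  by rewrite rmorphD alg_hom_scale.
- by move=> _ _ [x _ <-] [y _ <-]; exists (x * y) => //; rewrite rmorphM.
Qed.

(** The equalizer of [f] and [g] is a subalgebra containing [B]. *)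
Lemma alg_hom_eq_generates S T (B : set S) (f g : alg_hom S T) :
  generates B -> (forall e, B e -> f e = g e) -> f =1 g.
Proof.
move=> genB fg x; have : [set y | f y = g y] x; last by [].
rewrite (genB [set y | f y = g y]) //; split=> /=.
- by rewrite !rmorph1.
- by move=> a y z fgy fgz; rewrite !rmorphD !alg_hom_scale fgy fgz.
- by move=> y z fgy fgz; rewrite !rmorphM fgy fgz.
Qed.

End AlgebraFacts.

(** * Characters attached to ultrafilters *)

Section Characters.
Variables (R : comPzRingType) (S : comPzAlg R) (B U : set S).
Hypotheses (Bbool : boolean_subalgebra B) (Uultra : boolean_ultrafilter B U).

(** The elements that are scalar on some member of [U] form a subalgebra, by passing to the product
    of two members. It contains each [b] in [B], with scalar 1 on [b] or 0 on [1 - b], whichever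
    lies in [U]. *)
Lemma boolean_ultrafilter_local_scalar (s : S) :
  generates B -> exists a, exists2 e, U e & s * e = a *a: e.
Proof.
move=> genB; have U1 := boolean_ultrafilter1 Bbool Uultra.
case: Uultra Bbool => UB U0 UM UC [Bidem _ _ _ _].
suff : [set s | exists a, exists2 e, U e & s * e = a *a: e] s by [].
rewrite [X in X s]genB //.
- split.
  + by exists 1, 1 => //; rewrite /alg_scale rmorph1.
  + move=> a x y [b [e Ue xe]] [c [f Uf yf]].
    exists (a * b + c), (e * f); first exact: UM.
    have -> : (a *a: x + y) * (e * f) = a *a: (x * e) * f + (y * f) * e.
      by rewrite /alg_scale; ring.
    by rewrite xe yf /alg_scale rmorphD rmorphM; ring.
  + move=> x y [b [e Ue xe]] [c [f Uf yf]].
    exists (b * c), (e * f); first exact: UM.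
    have -> : (x * y) * (e * f) = (x * e) * (y * f) by ring.
    by rewrite xe yf /alg_scale rmorphM; ring.
- move=> b Bb; have [Ub|Ub] := UC _ Bb.
    by exists 1, b => //; rewrite /alg_scale rmorph1 mul1r; exact: Bidem.
  exists 0, (1 - b) => //.
  by rewrite /alg_scale rmorph0 mul0r mulrBr mulr1 (Bidem _ Bb) subrr.
Qed.

(* The character sends s to the scalar that s agrees with on some member of U;
   faithfulness makes this scalar unique. *)
Lemma boolean_ultrafilter_character :
  generates B -> (forall e, B e -> e != 0 -> faithful e) ->
  exists phi : spectrum S, forall e, U e -> phi e = 1.
Proof.
move=> genB faithB; have U1 := boolean_ultrafilter1 Bbool Uultra.
have [UB U0 UM UC] := Uultra.
have [val valP] := choice (fun s => boolean_ultrafilter_local_scalar s genB).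
have valE s a e : U e -> s * e = a *a: e -> val s = a.
  move=> Ue se; have [f Uf sf] := valP s.
  apply/eqP; rewrite -subr_eq0; apply/eqP.
  have Uef := UM _ _ Ue Uf.
  apply: (faithB (e * f)); first exact: UB.
    by apply/eqP => ef0; apply: U0; rewrite -ef0.
  have -> : (val s - a) *a: (e * f) = (val s *a: f) * e - (a *a: e) * f.
    by rewrite /alg_scale rmorphB; ring.
  by rewrite -se -sf; ring.
have valB : zmod_morphism val.
  move=> x y; have [e Ue xe] := valP x; have [f Uf yf] := valP y.
  apply: (valE _ _ (e * f)); first exact: UM.
  have -> : (x - y) * (e * f) = (x * e) * f - (y * f) * e by ring.
  by rewrite xe yf /alg_scale rmorphB; ring.
have valM : monoid_morphism val.
  split; first by apply: (valE _ _ 1) => //; rewrite /alg_scale rmorph1.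
  move=> x y; have [e Ue xe] := valP x; have [f Uf yf] := valP y.
  apply: (valE _ _ (e * f)); first exact: UM.
  have -> : (x * y) * (e * f) = (x * e) * (y * f) by ring.
  by rewrite xe yf /alg_scale rmorphM; ring.
pose phiB := GRing.isZmodMorphism.Build _ _ val valB.
pose phiM := GRing.isMonoidMorphism.Build _ _ val valM.
pose phi : {rmorphism S -> R} := HB.pack val phiB phiM.
have phiZ a x : phi (a *a: x) = (a : R) *a: (phi x : base_alg R).
  have [e Ue xe] := valP x; apply: (valE _ _ e) => //.
  rewrite /alg_scale -mulrA xe /alg_scale /= rmorphM; ring.
exists (@AlgHom R S (base_alg R) phi phiZ) => e Ue; apply: (valE _ _ e) => //.
case: Bbool => Bidem _ _ _ _.
by rewrite /alg_scale rmorph1 mul1r; exact/Bidem/UB.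
Qed.

End Characters.

(** * The topology of the spectrum *)

Section SpectrumTopology.
Variables (R : comPzRingType) (S : comPzAlg R).
Implicit Types (phi psi : spectrum S) (W : set (spectrum S)) (e : S).

Definition spectrum_basic e : set (spectrum S) := [set phi | phi e = 1].

(** All idempotents of [S] give basic sets, so the topology does not depend on a choice of
    generating Boolean algebra. *)
Definition spectrum_open : set_system (spectrum S) := [set W |
  forall phi, W phi -> exists e,
    [/\ idem e, spectrum_basic e phi & spectrum_basic e `<=` W]].

Lemma spectrum_openT : spectrum_open setT.
Proof.
move=> phi _; exists 1; split => //; last exact: rmorph1.
by rewrite /idem /= mulr1.
Qed.

Lemma spectrum_basicM e f : idem e -> idem f ->
  spectrum_basic (e * f) = spectrum_basic e `&` spectrum_basic f.
Proof.
rewrite /idem /= => ee ff; apply/seteqP.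
split=> phi /=; rewrite /spectrum_basic /=.
  move=> phief; split.
    have -> : phi e = phi e * phi (e * f) by rewrite phief mulr1.
    by rewrite -rmorphM mulrA ee.
  have -> : phi f = phi (e * f) * phi f by rewrite phief mul1r.
  by rewrite -rmorphM -mulrA ff.
by move=> [phie phif]; rewrite rmorphM phie phif mulr1.
Qed.

Lemma idemM e f : idem e -> idem f -> idem (e * f).
Proof. by rewrite /idem /= => ee ff; rewrite -[in RHS]ee -[in RHS]ff; ring. Qed.

Lemma spectrum_openI : setI_closed spectrum_open.
Proof.
move=> V W Vo Wo phi [/Vo[e [ee phie eV]] /Wo[f [ff phif fW]]].
exists (e * f); rewrite spectrum_basicM //; split => //; first exact: idemM.
exact: setISS.
Qed.

Lemma spectrum_open_bigcup (I : Type) (W : I -> set (spectrum S)) :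
  (forall i, spectrum_open (W i)) -> spectrum_open (\bigcup_i W i).
Proof.
move=> Wo phi [i _ /Wo[e [ee phie eW]]]; exists e; split => //.
by move=> psi /eW; exists i.
Qed.

HB.instance Definition _ := isOpenTopological.Build (spectrum S)
  spectrum_openT spectrum_openI spectrum_open_bigcup.

Lemma spectrum_openE W : open W = spectrum_open W.
Proof. by []. Qed.

Lemma spectrum_basic_open e : idem e -> open (spectrum_basic e).
Proof. by rewrite spectrum_openE => ee phi phie; exists e; split. Qed.

End SpectrumTopology.

(** * The spectrum as a Stone space *)

Section SpectrumStone.
Variables (R : comNzRingType) (hR : indecomposable R) (S : comPzAlg R).
Implicit Types (phi psi : spectrum S) (e : S).

(** Indecomposability enters here: [phi e] is an idempotent of [R]. *)
Lemma spectrum_idem phi e : idem e -> phi e = 0 \/ phi e = 1.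
Proof. by move=> ee; apply: hR; rewrite /idem /= -rmorphM ee. Qed.

Lemma idem_compl e : idem e -> idem (1 - e).
Proof.
by rewrite /idem /= => ee; rewrite mulrBr mulr1 mulrBl mul1r ee subrr subr0.
Qed.

Lemma spectrum_basicC e :
  idem e -> ~` spectrum_basic e = spectrum_basic (1 - e).
Proof.
move=> ee; apply/seteqP.
split=> phi; rewrite /spectrum_basic /= rmorphB rmorph1.
  by have [->|] := spectrum_idem phi ee; rewrite ?subr0.
move=> phie1 phie; move: phie1; rewrite phie subrr => /esym/eqP.
by rewrite oner_eq0.
Qed.

Lemma spectrum_basic_clopen e : idem e -> clopen (spectrum_basic e).
Proof.
move=> ee; split; first exact: spectrum_basic_open.
by rewrite -openC spectrum_basicC //; exact/spectrum_basic_open/idem_compl.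
Qed.

Lemma spectrum_clopen_basis : basis (@clopen (spectrum S)).
Proof.
split=> [W []//|phi W]; rewrite /= nbhsE => -[V [+ Vphi] VW].
rewrite spectrum_openE => /(_ _ Vphi)[e [ee phie eV]].
exists (spectrum_basic e); last exact: subset_trans VW.
by split => //; exact: spectrum_basic_clopen.
Qed.

Section GeneratingAlgebra.
Variable B : set S.
Hypotheses (Bbool : boolean_subalgebra B) (genB : generates B).

(** Distinct characters differ at some [e] in [B], and are then separated by the disjoint basic sets
    of [e] and [1 - e]. *)
Lemma spectrum_hausdorff : hausdorff_space (spectrum S).
Proof.
have [Bidem _ _ _ BN] := Bbool.
move=> phi psi phipsi; apply/alg_hom_ext/(alg_hom_eq_generates genB) => e Be.
have [phie|phie] := spectrum_idem phi (Bidem _ Be).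
- have nphi : nbhs phi (spectrum_basic (1 - e)).
    apply: open_nbhs_nbhs; split; first exact/spectrum_basic_open/Bidem/BN.
    by rewrite /spectrum_basic /= rmorphB rmorph1 phie subr0.
  have [//|psie] := spectrum_idem psi (Bidem _ Be); first by rewrite phie.
  have npsi : nbhs psi (spectrum_basic e).
    by apply: open_nbhs_nbhs; split; first exact/spectrum_basic_open/Bidem.
  have [chi []] := phipsi _ _ nphi npsi.
  by rewrite -spectrum_basicC; [|exact: Bidem].
- have nphi : nbhs phi (spectrum_basic e).
    by apply: open_nbhs_nbhs; split; first exact/spectrum_basic_open/Bidem.
  have [psie|psie] := spectrum_idem psi (Bidem _ Be); last by rewrite phie.
  have npsi : nbhs psi (spectrum_basic (1 - e)).
    apply: open_nbhs_nbhs; split; first exact/spectrum_basic_open/Bidem/BN.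
    by rewrite /spectrum_basic /= rmorphB rmorph1 psie subr0.
  have [chi []] := phipsi _ _ nphi npsi.
  by rewrite -spectrum_basicC; [|exact: Bidem].
Qed.

Lemma spectrum_boolean_ultrafilter phi :
  boolean_ultrafilter B [set e | B e /\ phi e = 1].
Proof.
have [Bidem _ _ BM BN] := Bbool; split.
- by move=> e [].
- by move=> [_]; rewrite rmorph0 => /esym/eqP; rewrite oner_eq0.
- move=> e f /= [Be phie] [Bf phif]; split; first by have [] := BM _ _ Be Bf.
  by rewrite rmorphM phie phif mulr1.
- move=> b Bb /=; have [phib|] := spectrum_idem phi (Bidem _ Bb); last by left.
  by right; split; [exact: BN|rewrite rmorphB rmorph1 phib subr0].
Qed.

(** The ultrafilter of [phi] gives [s * e = a *a: e] with [phi e = 1]; every character in the basic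
    set of [e] then sends [s] to [a]. *)
Lemma spectrum_eval_locally_constant phi (s : S) :
  \forall psi \near phi, (psi : spectrum S) s = phi s.
Proof.
have Bidem : B `<=` @idem S by case: Bbool.
have [a [e [Be phie] se]] :=
  boolean_ultrafilter_local_scalar Bbool
    (spectrum_boolean_ultrafilter phi) s genB.
have eval psi : psi e = 1 -> psi s = a.
  by move=> psie; rewrite -[LHS]mulr1 -psie -rmorphM se spectrumZ psie mulr1.
apply: (filterS (P := spectrum_basic e)).
  by move=> psi psie; rewrite !eval.
by apply: open_nbhs_nbhs; split => //; exact/spectrum_basic_open/Bidem.
Qed.

Hypothesis faithB : forall e, B e -> e != 0 -> faithful e.

(** A nonzero [s] stays nonzero on every member of some ultrafilter, yet the character of that
    ultrafilter sends [s] to its local scalar, which would be 0. *)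
Lemma spectrum_eval_injective (s : S) :
  (forall phi, phi s = 0) -> s = 0.
Proof.
move=> phis; apply: contrapT => /eqP /(exists_boolean_ultrafilter Bbool).
move=> [U Uultra Us].
have [phi phiU] := boolean_ultrafilter_character Bbool Uultra genB faithB.
have [a [e Ue se]] := boolean_ultrafilter_local_scalar Bbool Uultra s genB.
have a0 : a = 0.
  have := congr1 phi se; rewrite rmorphM spectrumZ phis phiU //.
  by rewrite mul0r mulr1.
by move: (Us _ Ue); rewrite se a0 /alg_scale rmorph0 mul0r eqxx.
Qed.

(** An ultrafilter [F] on the spectrum traces an ultrafilter on [B], and [F] converges to the
    character of the latter. *)
Lemma spectrum_compact : compact [set: spectrum S].
Proof.
have [Bidem B0 _ BM BN] := Bbool.
rewrite compact_ultra => F FU _.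
pose U := [set e | B e /\ F (spectrum_basic e)].
have Uultra : boolean_ultrafilter B U.
  split.
  - by move=> e [].
  - move=> [_ F0]; apply: (@filter_not_empty _ F _); apply: filterS F0 => phi.
    by rewrite /spectrum_basic /= rmorph0 => /esym/eqP; rewrite oner_eq0.
  - move=> e f [Be Fe] [Bf Ff]; split; first by have [] := BM _ _ Be Bf.
    by rewrite spectrum_basicM; [exact: filterI|exact: Bidem..].
  - move=> b Bb; have [Fb|] := in_ultra_setVsetC (spectrum_basic b) FU.
      by left.
    by rewrite spectrum_basicC; [right; split => //; exact: BN|exact: Bidem].
have [phi phiU] := boolean_ultrafilter_character Bbool Uultra genB faithB.
exists phi; split => // W /=; rewrite nbhsE => -[V [+ Vphi] VW].
rewrite spectrum_openE => /(_ _ Vphi)[e [ee phie eV]].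
(* The idempotent [e] need not lie in [B], but it has local scalar [phi e = 1] on some [f] in [U],
   so the basic set of [f] lies inside that of [e]. *)
have [a [f Uf ef]] := boolean_ultrafilter_local_scalar Bbool Uultra e genB.
have a1 : a = 1.
  have := congr1 phi ef; rewrite rmorphM spectrumZ phie phiU //.
  by rewrite !mulr1.
have [Bf Ff] := Uf; apply: filterS Ff => psi psif; apply/VW/eV.
rewrite /spectrum_basic /= -[LHS]mulr1 -psif -rmorphM ef a1.
by rewrite spectrumZ mul1r.
Qed.

End GeneratingAlgebra.

End SpectrumStone.

(** * Compactness and locally constant functions *)

(** If [P setT] failed, the sets whose complement satisfies [P] would form a proper filter; a
    neighbourhood satisfying [P] of a cluster point would then meet its own complement. *)
Lemma compact_ind (X : topologicalType) (P : set (set X)) :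
  compact [set: X] ->
  P set0 -> (forall V W, V `<=` W -> P W -> P V) ->
  (forall V W, P V -> P W -> P (V `|` W)) ->
  (forall x : X, exists2 W : set X, nbhs x W & P W) -> P setT.
Proof.
move=> cptX P0 Psub PU Ploc; apply: contrapT => PT.
pose F : set_system X := [set W | P (~` W)].
have FF : ProperFilter F.
  split; first by rewrite /F /= setC0.
  split; rewrite /F /=.
  - by rewrite setCT.
  - by move=> V W PV PW; rewrite /mkset setCI; exact: PU.
  - by move=> V W VW; apply: Psub; exact: subsetC.
have [|x [_ xF]] := cptX F FF; first by rewrite /F /= setCT.
have [W Wx PW] := Ploc x.
have [|y [nWy Wy]//] := xF (~` W) W _ Wx.
by rewrite /F /= setCK.
Qed.

Section LocallyConstant.
Variables (X : topologicalType) (R : comPzRingType).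

Definition locally_constant : {pred X -> R} :=
  [pred f : X -> R | `[< forall x, \forall y \near x, f y = f x >]].

Lemma locally_constantP (f : X -> R) :
  reflect (forall x, \forall y \near x, f y = f x) (f \in locally_constant).
Proof. exact: asboolP. Qed.

Lemma locally_constant_subring : subring_closed locally_constant.
Proof.
split.
- by apply/locally_constantP => x; near=> y.
- move=> f g /locally_constantP fl /locally_constantP gl.
  by apply/locally_constantP => x; apply: filterS2 (fl x) (gl x) => y fy gy;
     rewrite /GRing.add /GRing.opp /= fy gy.
- move=> f g /locally_constantP fl /locally_constantP gl.
  by apply/locally_constantP => x; apply: filterS2 (fl x) (gl x) => y fy gy;
     rewrite /GRing.mul /= fy gy.
Unshelve. all: by end_near. Qed.

(** The ring structure derived below may be trivial, as it is for empty [X]. *)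
Record lcfun := LCFun {
  lcfun_val :> X -> R;
  lcfunP : lcfun_val \in locally_constant }.

HB.instance Definition _ := [isSub for lcfun_val].
HB.instance Definition _ := [Choice of lcfun by <:].
HB.instance Definition _ := GRing.SubChoice_isSubComPzRing.Build _ _ lcfun
  locally_constant_subring.

Lemma lcfun_near (f : lcfun) x : \forall y \near x, f y = f x.
Proof. exact/locally_constantP/lcfunP. Qed.

Lemma lcfun_ext (f g : lcfun) : f =1 g -> f = g.
Proof. by move=> fg; apply/val_inj/funext. Qed.

Lemma lcfun0 x : (0 : lcfun) x = 0. Proof. by []. Qed.
Lemma lcfun1 x : (1 : lcfun) x = 1. Proof. by []. Qed.
Lemma lcfunD (f g : lcfun) x : (f + g) x = f x + g x. Proof. by []. Qed.
Lemma lcfunN (f : lcfun) x : (- f) x = - f x. Proof. by []. Qed.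
Lemma lcfunM (f g : lcfun) x : (f * g) x = f x * g x. Proof. by []. Qed.
Definition lcfunE := (lcfun0, lcfun1, lcfunD, lcfunN, lcfunM).

Lemma cst_locally_constant (a : R) : (fun=> a) \in locally_constant.
Proof.
by apply/locally_constantP => x; near=> y.
Unshelve. all: by end_near. Qed.

Definition lcfun_cst (a : R) : lcfun := LCFun (cst_locally_constant a).

Lemma lcfun_cst_zmod : zmod_morphism lcfun_cst.
Proof. by move=> a b; apply: lcfun_ext. Qed.

Lemma lcfun_cst_monoid : monoid_morphism lcfun_cst.
Proof. by split=> [|a b]; apply: lcfun_ext. Qed.

HB.instance Definition _ := GRing.isZmodMorphism.Build _ _ _ lcfun_cst_zmod.
HB.instance Definition _ := GRing.isMonoidMorphism.Build _ _ _ lcfun_cst_monoid.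

Definition lcfun_alg : comPzAlg R := @ComPzAlg R lcfun lcfun_cst.

Lemma lcfunZ (a : R) (f : lcfun_alg) x : (a *a: f : lcfun_alg) x = a * f x.
Proof. by []. Qed.

Lemma indicator_locally_constant (W : set X) :
  clopen W -> (fun x => (x \in W)%:R : R) \in locally_constant.
Proof.
move=> [Wo Wc]; apply/locally_constantP => x.
have [Wx|nWx] := pselect (W x).
- apply: (filterS (P := W)); last exact: open_nbhs_nbhs.
  by move=> y Wy; rewrite !mem_set.
- apply: (filterS (P := ~` W)).
    by move=> y nWy; rewrite !memNset.
  by apply: open_nbhs_nbhs; split; first rewrite openC.
Qed.

Definition indicator (W : set X) (Wclopen : clopen W) : lcfun_alg :=
  LCFun (indicator_locally_constant Wclopen).

Lemma indicatorE (W : set X) (Wclopen : clopen W) x :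
  indicator Wclopen x = (x \in W)%:R.
Proof. by []. Qed.

Lemma idem_indicator (W : set X) (Wclopen : clopen W) :
  idem (indicator Wclopen).
Proof.
apply: lcfun_ext => x; rewrite lcfunM !indicatorE.
by case: (_ \in _); rewrite ?mulr1 ?mulr0.
Qed.

(* A Stone-Weierstrass theorem: near x, f agrees with the scalar f x, so f * e
   is in A for a suitable e with e x = 1; since f * (e + e' - e * e') is in A
   when f * e and f * e' are, compactness reaches e = 1. *)
Lemma separating_subalgebra_full (A : set lcfun_alg) :
  compact [set: X] -> subalgebra A ->
  (forall x W, nbhs x W -> exists e : lcfun_alg,
    [/\ A e, e x = 1 & forall y, ~ W y -> e y = 0]) ->
  A = setT.
Proof.
move=> cptX [A1 AZD AM] Asep; apply/seteqP; split=> // f _.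
have AD (g h : lcfun_alg) : A g -> A h -> A (g + h).
  move=> Ag Ah; have := AZD 1 g h Ag Ah.
  by rewrite /alg_scale rmorph1 mul1r.
have AB (g h : lcfun_alg) : A g -> A h -> A (g - h).
  move=> Ag Ah; have := AZD (- 1) h g Ah Ag.
  by rewrite /alg_scale rmorphN1 mulN1r addrC.
have [||||e [Ae eT]] := @compact_ind X [set W | exists e : lcfun_alg,
  [/\ A e, A (f * e) & forall y, W y -> e y = 1]] cptX.
- exists 0; have A0 : A 0 by rewrite -(subrr 1); exact: AB.
  by split; rewrite ?mulr0.
- move=> V W VW [e [Ae Afe eW]]; exists e; split => // y Vy.
  exact/eW/VW.
- move=> V W [e [Ae Afe eV]] [e' [Ae' Afe' eW]].
  exists (e + e' - e * e'); split.
  + by apply: AB; [exact: AD|exact: AM].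
  + have -> : f * (e + e' - e * e') = f * e + f * e' - (f * e) * e' by ring.
    by apply: AB; [exact: AD|exact: AM].
  + move=> y [Vy|Wy]; rewrite lcfunE.
      by rewrite lcfunE lcfunN lcfunM eV // mul1r addrK.
    by rewrite lcfunE lcfunN lcfunM eW // mulr1 addrC addKr.
- move=> x; have [e [Ae ex e0]] := Asep x _ (lcfun_near f x).
  exists [set y | e y = 1]; first by rewrite -ex; exact: lcfun_near.
  exists e; split => //.
  (* The summand [1 - 1] is a zero, added to match the closure clause for [a *a: x + y]. *)
  have -> : f * e = f x *a: e + (1 - 1).
    apply: lcfun_ext => y; rewrite subrr addr0 lcfunM lcfunZ.
    have [->//|fy] := pselect (f y = f x).
    by rewrite e0 // !mulr0.
  by apply: AZD => //; exact: AB.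
- move=> e1; suff -> : f = f * e by [].
  by apply: lcfun_ext => y; rewrite lcfunM e1 // mulr1.
Qed.

End LocallyConstant.

Lemma idem_boolean_subalgebra (S : comPzRingType) :
  boolean_subalgebra (@idem S).
Proof.
split; rewrite /idem //=; [by rewrite mul0r|by rewrite mulr1| |].
- move=> e f ee ff; split; last by rewrite -[in RHS]ee -[in RHS]ff; ring.
  (* The square is expanded with [e * e] and [f * f] kept visible, ready for rewriting by
     idempotence. *)
  have -> : (e + f - e * f) * (e + f - e * f) =
    e * e + f * f + (e * e) * (f * f) + e * f *+ 2 - (e * e) * f *+ 2 - e * (f * f) *+ 2 by ring.
  by rewrite ee ff; ring.
- by move=> e ee; rewrite mulrBr mulr1 mulrBl mul1r ee subrr subr0.
Qed.

(** * Functoriality of both constructions *)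

Section Functoriality.
Variable R : comPzRingType.

Section SpectrumMap.
Variables (S T : comPzAlg R) (f : alg_hom S T).

Definition spectrum_map (phi : spectrum T) : spectrum S := alg_hom_comp phi f.

(** The preimage of the basic set of [e] is the basic set of [f e]. *)
Lemma spectrum_map_continuous : continuous spectrum_map.
Proof.
apply/continuousP => W; rewrite !spectrum_openE => Wo phi /Wo[e [ee phie eW]].
exists (f e); split => //; first by rewrite /idem /= -rmorphM ee.
by move=> psi psie; exact: eW.
Qed.

End SpectrumMap.

Section LcfunMap.
Variables (X Y : topologicalType) (f : continuousType X Y).

Lemma lcfun_comp_subproof (g : lcfun Y R) : (g \o f) \in @locally_constant X R.
Proof.
by apply/locally_constantP => x; exact: cts_fun (lcfun_near g (f x)).
Qed.

Definition lcfun_comp (g : lcfun Y R) : lcfun X R :=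
  LCFun (lcfun_comp_subproof g).

Lemma lcfun_comp_zmod : zmod_morphism lcfun_comp.
Proof. by move=> g h; apply: lcfun_ext. Qed.

Lemma lcfun_comp_monoid : monoid_morphism lcfun_comp.
Proof. by split=> [|g h]; apply: lcfun_ext. Qed.

HB.instance Definition _ := GRing.isZmodMorphism.Build _ _ _ lcfun_comp_zmod.
HB.instance Definition _ := GRing.isMonoidMorphism.Build _ _ _
  lcfun_comp_monoid.

Lemma lcfun_compZ (a : R) (g : lcfun_alg Y R) :
  lcfun_comp (a *a: g) = (a *a: (lcfun_comp g : lcfun_alg X R)).
Proof. exact: lcfun_ext. Qed.

Definition lcfun_map : alg_hom (lcfun_alg Y R) (lcfun_alg X R) :=
  @AlgHom R (lcfun_alg Y R) (lcfun_alg X R) lcfun_comp lcfun_compZ.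

End LcfunMap.

Section PointEvaluation.
Variables (X : topologicalType) (x : X).

Definition point_eval (f : lcfun X R) : R := f x.

Lemma point_eval_zmod : zmod_morphism point_eval. Proof. by []. Qed.
Lemma point_eval_monoid : monoid_morphism point_eval. Proof. by []. Qed.

HB.instance Definition _ := GRing.isZmodMorphism.Build _ _ _ point_eval_zmod.
HB.instance Definition _ := GRing.isMonoidMorphism.Build _ _ _
  point_eval_monoid.

Definition point_character : spectrum (lcfun_alg X R) :=
  @AlgHom R (lcfun_alg X R) (base_alg R) point_eval (fun a f => erefl).

Lemma point_characterE (f : lcfun_alg X R) : point_character f = f x.
Proof. by []. Qed.

End PointEvaluation.

Lemma point_character_continuous (X : topologicalType) :
  continuous (@point_character X).
Proof.
apply/continuousP => W; rewrite spectrum_openE openE => Wo x /Wo[e [_ ex eW]].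
apply: filterS (lcfun_near e x) => y ey; apply: eW.
by rewrite /spectrum_basic /= [LHS]ey.
Qed.

End Functoriality.

Section Duality.
Variables (R : comNzRingType) (hR : indecomposable R).

(** * The Gelfand transform of a Specker algebra *)

Section SpeckerToStone.
Variable S : comPzAlg R.
Hypothesis Sspecker : specker S.

Lemma specker_spectrum_compact : compact [set: spectrum S].
Proof.
have [B [Bbool genB faithB]] := Sspecker; exact: (spectrum_compact hR Bbool).
Qed.

Lemma specker_spectrum_hausdorff : hausdorff_space (spectrum S).
Proof.
have [B [Bbool genB _]] := Sspecker; exact: (spectrum_hausdorff hR Bbool).
Qed.

Lemma gelfand_locally_constant (s : S) :
  (fun phi : spectrum S => phi s : R) \in @locally_constant (spectrum S) R.
Proof.
have [B [Bbool genB _]] := Sspecker.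
apply/locally_constantP => phi.
exact: (spectrum_eval_locally_constant hR Bbool).
Qed.

Definition gelfand_fun (s : S) : lcfun (spectrum S) R :=
  LCFun (gelfand_locally_constant s).

Lemma gelfand_zmod : zmod_morphism gelfand_fun.
Proof. by move=> s t; apply: lcfun_ext => phi; exact: rmorphB. Qed.

Lemma gelfand_monoid : monoid_morphism gelfand_fun.
Proof.
by split=> [|s t]; apply: lcfun_ext => phi; [exact: rmorph1|exact: rmorphM].
Qed.

HB.instance Definition _ := GRing.isZmodMorphism.Build _ _ _ gelfand_zmod.
HB.instance Definition _ := GRing.isMonoidMorphism.Build _ _ _ gelfand_monoid.

Lemma gelfandZ (a : R) (s : S) :
  gelfand_fun (a *a: s) = (a *a: (gelfand_fun s : lcfun_alg (spectrum S) R)).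
Proof. by apply: lcfun_ext => phi; exact: spectrumZ. Qed.

Definition gelfand : alg_hom S (lcfun_alg (spectrum S) R) :=
  @AlgHom R S (lcfun_alg (spectrum S) R) gelfand_fun gelfandZ.

Lemma gelfand_bij : bijective gelfand.
Proof.
have [B [Bbool genB faithB]] := Sspecker.
have inj : injective gelfand.
  move=> s t st; apply/eqP; rewrite -subr_eq0; apply/eqP.
  apply: (spectrum_eval_injective Bbool genB faithB) => phi.
  have /(congr1 (fun f : lcfun _ _ => f phi)) stphi := st.
  by rewrite rmorphB; apply/eqP; rewrite subr_eq0; apply/eqP.
have surj : range gelfand = setT.
  apply: separating_subalgebra_full.
  - exact: specker_spectrum_compact.
  - exact: range_subalgebra.
  - move=> phi W; rewrite nbhsE => -[V [+ Vphi] VW].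
    rewrite spectrum_openE => /(_ _ Vphi)[e [ee phie eV]].
    (* The transform of [e] takes only the values 0 and 1, and equals 1 exactly on the basic set of
       [e]. *)
    exists (gelfand e); split; [by exists e|by []|] => psi nWpsi.
    have [//|psie] := spectrum_idem hR psi ee.
    by case: nWpsi; exact/VW/eV.
have /choice[g gK] : forall f, exists s, gelfand s = f.
  by move=> f; have [s _ <-] : range gelfand f; [rewrite surj|exists s].
by exists g => // s; apply: inj; rewrite gK.
Qed.

End SpeckerToStone.

(** * Stone spaces as spaces of characters *)

Section StoneToSpecker.
Variable X : stoneSpace.
Local Notation A := (lcfun_alg X R).

Lemma stone_clopen_nbhs (x : X) W : nbhs x W ->
  exists U : set X, [/\ clopen U, U x & U `<=` W].
Proof.
by move=> xW; have [_ /(_ x W xW)[U [Ucl Ux] UW]] := stone_basis X; exists U.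
Qed.

(** Indicators of clopen neighbourhoods are idempotents that provide the separation needed for the
    Stone-Weierstrass argument. *)
Lemma lcfun_idem_generates : generates (@idem A).
Proof.
move=> C Calg idemC; apply: separating_subalgebra_full => //.
  exact: stone_compact.
move=> x W /stone_clopen_nbhs[U [Ucl Ux UW]].
exists (indicator R Ucl); split.
- exact/idemC/idem_indicator.
- by rewrite indicatorE mem_set.
- by move=> y nWy; rewrite indicatorE memNset // => /UW.
Qed.

Lemma lcfun_idem_values (e : A) x : idem e -> e x = 0 \/ e x = 1.
Proof. by move=> ee; apply: hR; rewrite /idem /= -lcfunM ee. Qed.

(** All idempotents serve as generating algebra. If [a *a: e = 0] with [a] nonzero, evaluation shows
    that [e] is 1 nowhere, hence 0. *)
Lemma lcfun_specker : specker A.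
Proof.
exists (@idem A); split.
- exact: idem_boolean_subalgebra.
- exact: lcfun_idem_generates.
- move=> e ee e0 a ae; apply: contrapT => a0; move/eqP: e0; apply.
  apply: lcfun_ext => x; have [//|ex] := lcfun_idem_values x ee.
  case: a0; have := congr1 (fun f : lcfun _ _ => f x) ae.
  by rewrite lcfunZ ex mulr1.
Qed.

Lemma point_character_bij : bijective (@point_character R X).
Proof.
(* If [x] and [y] give the same character, the indicator of a clopen neighbourhood of [x] is also 1
   at [y], so [x] and [y] have no disjoint neighbourhoods. *)
have inj : injective (@point_character R X).
  move=> x y xy; apply: (stone_hausdorff (s := X)) => V W Vx Wy.
  have [U [Ucl Ux UV]] := stone_clopen_nbhs Vx.
  have := congr1 (fun phi : spectrum A => phi (indicator R Ucl) : R) xy.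
  rewrite !point_characterE !indicatorE mem_set //.
  case: (boolP (y \in U)) => [/set_mem Uy _|_ /eqP].
    by exists y; split; [exact: UV|exact: nbhs_singleton].
  by rewrite oner_eq0.
suff /choice[g gK] : forall phi : spectrum A,
    exists x, point_character R x = phi.
  by exists g => // x; apply: inj; rewrite gK.
move=> phi.
(* phi is evaluation at any cluster point of the sets [set x | e x = 1] with
   phi e = 1. *)
pose F : set_system X :=
  [set W | exists e : A, [/\ idem e, phi e = 1 & forall x, e x = 1 -> W x]].
have FF : ProperFilter F.
  split.
    move=> [e [ee phie eF]].
    have e0 : e = 0.
      by apply: lcfun_ext => x; have [//|/eF] := lcfun_idem_values x ee.
    by move: phie; rewrite e0 rmorph0 => /esym/eqP; rewrite oner_eq0.
  split.
  - by exists 1; split => //; [rewrite /idem /= mulr1|exact: rmorph1].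
  - move=> V W [e [ee phie eV]] [f [ff phif fW]].
    exists (e * f); split; [exact: idemM|by rewrite rmorphM phie phif mulr1|].
    move=> x; rewrite lcfunM.
    have [->|ex] := lcfun_idem_values x ee.
      by rewrite mul0r => /esym/eqP; rewrite oner_eq0.
    by rewrite ex mul1r => fx; split; [exact: eV|exact: fW].
  - by move=> V W VW [e [ee phie eV]]; exists e; split => // x /eV/VW.
have [|x [_ xF]] := stone_compact (s := X) FF.
  by exists 1; split => //; [rewrite /idem /= mulr1|exact: rmorph1].
have phi1 (e : A) : idem e -> phi e = 1 -> e x = 1.
  move=> ee phie; have Fe : F (e @^-1` [set 1]) by exists e; split.
  (* Clustering at [x] yields a point where [e] is 1 inside the neighbourhood on which [e] is
     constantly [e x]. *)
  have [y [/= ey1 yx]] := xF _ _ Fe (lcfun_near e x).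
  by rewrite -yx.
exists x; apply/alg_hom_ext/(alg_hom_eq_generates lcfun_idem_generates) => e ee.
have [phie|phie] := spectrum_idem hR phi ee; rewrite phie; last exact: phi1.
(* The value 0 of [phi] at [e] is treated as the value 1 at [1 - e]. *)
have := phi1 _ (idem_compl ee); rewrite rmorphB rmorph1 phie subr0 lcfunD.
move=> /(_ erefl) /eqP; rewrite lcfunN lcfun1 -subr_eq0 addrAC subrr add0r.
by rewrite oppr_eq0 => /eqP.
Qed.

(** By surjectivity, the image of a clopen set is the basic set of its indicator. This yields
    continuity of the inverse. *)
Lemma point_character_open (W : set X) (phi : spectrum A) (x : X) :
  point_character R x = phi -> nbhs x W -> nbhs phi (@point_character R X @` W).
Proof.
move=> <- /stone_clopen_nbhs[U [Ucl Ux UW]].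
have [g _ gK] := point_character_bij.
apply: (filterS (P := spectrum_basic (indicator R Ucl))).
  move=> psi; rewrite /spectrum_basic /= -(gK psi) point_characterE indicatorE.
  case: (boolP (_ \in _)) => [/set_mem Ug _|_ /esym/eqP]; last first.
    by rewrite oner_eq0.
  by exists (g psi) => //; exact: UW.
apply: open_nbhs_nbhs; split; first exact/spectrum_basic_open/idem_indicator.
by rewrite /spectrum_basic /mkset point_characterE indicatorE mem_set.
Qed.

End StoneToSpecker.

(** * The two functors and the equivalence *)

Definition spectrum_stone (S : speckerAlg R) : stoneSpace :=
  StoneSpace (spectrum_clopen_basis hR S)
    (specker_spectrum_compact (specker_sortP S))
    (specker_spectrum_hausdorff (specker_sortP S)).

Definition lcfun_specker_alg (X : stoneSpace) : speckerAlg R :=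
  SpeckerAlg (lcfun_specker X).

Definition spectrum_functor : functor (opposite (Sp R)) Stone.
Proof.
exists spectrum_stone (fun (S T : speckerAlg R) (f : alg_hom T S) =>
  mkcts (@spectrum_map_continuous R T S f) :
    continuousType (spectrum_stone S) (spectrum_stone T)).
- by move=> S; apply/continuousEP => phi; apply: alg_hom_ext.
- by move=> S T U g f; apply/continuousEP => phi; apply: alg_hom_ext.
Defined.

Definition lcfun_functor : functor Stone (opposite (Sp R)).
Proof.
exists lcfun_specker_alg
  (fun (X Y : stoneSpace) (f : continuousType X Y) => lcfun_map R f).
- by move=> X; apply: alg_hom_ext => f; apply: lcfun_ext.
- by move=> X Y Z g f; apply: alg_hom_ext => h; apply: lcfun_ext.
Defined.

(** The transform goes from [S] to functions on its spectrum; in the opposite category it points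
    from the composite to the identity. *)
Lemma gelfand_natural_iso :
  naturally_isomorphic (functor_comp lcfun_functor spectrum_functor)
    (functor_id (opposite (Sp R))).
Proof.
exists (fun S : speckerAlg R => gelfand (specker_sortP S)); split.
- by move=> S T f; apply: alg_hom_ext => s; apply: lcfun_ext.
- move=> S; have [g [gelK gK]] :=
    alg_hom_bij_inverse (gelfand_bij (specker_sortP S)).
  by exists g; split; apply: alg_hom_ext.
Qed.

Lemma point_character_natural_iso :
  naturally_isomorphic (functor_id Stone)
    (functor_comp spectrum_functor lcfun_functor).
Proof.
exists (fun X : stoneSpace => mkcts (@point_character_continuous R X) :
  continuousType X (spectrum_stone (lcfun_specker_alg X))); split.
- by move=> X Y f; apply/continuousEP => x; apply: alg_hom_ext.
- move=> X; have [g pK gK] := point_character_bij X.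
  have gcts : continuous (g : spectrum (lcfun_alg X R) -> X).
    move=> phi W /(point_character_open (gK phi)).
    by apply: filterS => psi [x Wx <-]; rewrite /= pK.
  exists (mkcts gcts : continuousType (spectrum_stone (lcfun_specker_alg X)) X).
  by split; apply/continuousEP.
Qed.

End Duality.

Theorem corollary3p9 (R : comNzRingType) (hR : indecomposable R) :
  dually_equivalent (Sp R) Stone.
Proof.
exists (spectrum_functor hR), (lcfun_functor hR); split.
  (* Both natural isomorphisms were built in the direction opposite to the one [equivalent] asks
     for. *)
  exact/naturally_isomorphic_sym/gelfand_natural_iso.
exact/naturally_isomorphic_sym/point_character_natural_iso.
Qed.
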